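(* Let $|\psi\rangle$ be a core state whose stellar polynomial is homogeneous of degree $d$ (a homogeneous multiphoton state with $d$ photons), and suppose $|\psi\rangle$ has $M\ge 2$ intrinsic modes. Then every single-ancilla protocol preparing $|\psi\rangle$ (up to a nonzero scalar) uses a number $N$ of photon additions satisfying $N\ge\max(d,M)$.
   Context: Modes and states. Each bosonic mode $j$ has creation/annihilation operators $\hat a_j^\dagger,\hat a_j$ with $[\hat a_j,\hat a_k^\dagger]=\delta_{jk}$; $|\mathbf 0\rangle$ is the multimode vacuum and $|n\rangle=(\hat a^\dagger)^n|0\rangle/\sqrt{n!}$. A core state of finitely many modes is a nonzero vector with finite support in the Fock basis, $|\psi\rangle=\sum_{\mathbf n}\psi_{\mathbf n}|\mathbf n\rangle$. Its stellar polynomial is $P_\psi(\mathbf x)=\sum_{\mathbf n}\frac{\psi_{\mathbf n}}{\sqrt{\mathbf n!}}\mathbf x^{\mathbf n}$, so that $|\psi\rangle=P_\psi(\hat{\mathbf a}^\dagger)|\mathbf 0\rangle$. States are considered up to nonzero scalars. Number of intrinsic modes: the minimum, over all choices of mode basis (i.e. over all unitary changes of the modes, $\hat a_j^\dagger\mapsto\sum_kV_{kj}\hat a_k^\dagger$ with $V$ unitary), of the number of modes that are not in the vacuum state, i.e. of the number of variables on which the transformed stellar polynomial depends. Operations. Photon addition on mode $j$: $|\phi\rangle\mapsto\hat a_j^\dagger|\phi\rangle$. Multiport interferometer: a unitary on Fock space fixing the vacuum and acting by a unitary matrix $V$ as $\hat a_j^\dagger\mapsto\sum_k V_{kj}\hat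 a_k^\dagger$. Projection of mode $j$ onto $n$ photons: $|\phi\rangle\mapsto\langle n|_j|\phi\rangle$ (a vector of the remaining modes). Single-ancilla protocol: start from the vacuum of the target modes and one ancillary mode, apply any finite sequence of photon additions and multiport interferometers on all these modes, then project the ancillary mode onto a Fock state $|n\rangle$ for some $n\ge0$. *)

(* Defs.v *)
(* The Fock space of m bosonic modes enters through its dense subspace of core
   vectors (finite linear combinations of Fock basis states), which contains
   every state occurring below and is the common domain of the creation
   operators.  Definitions are made over any numClosedFieldType C, to be
   instantiated by the complex numbers. *)
From HB Require Import structures.
From mathcomp Require Import all_boot all_order all_algebra.
From mathcomp Require Export reals complex.
From mathcomp Require Export freeg mpoly.

Set Implicit Arguments.
Unset Strict Implicit.
Unset Printing Implicit Defensive.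

Import Order.TTheory GRing.Theory Num.Theory.
Local Open Scope ring_scope.

(* << x *g n >> is x |n>, and coeff n phi is the amplitude <n|phi>. *)
Notation fock C m := {freeg 'X_{1..m} / C}.

Section Fock.

Variables (C : numClosedFieldType) (m : nat).
Implicit Types (phi psi : fock C m) (n : 'X_{1..m}) (V : 'M[C]_m).

Definition vacuum : fock C m := << 1 *g 0%MM >>.

(* Linear in the second argument. *)
Definition braket phi psi : C :=
  \sum_(n <- dom phi) (coeff n phi)^* * coeff n psi.

(* a_j^dagger |n> = sqrt (n_j + 1) |n + e_j> *)
Definition creation (j : 'I_m) phi : fock C m :=
  \sum_(n <- dom phi)
    << coeff n phi * sqrtC (n j).+1%:R *g (n + U_(j))%MM >>.

Definition stellar phi : {mpoly C[m]} :=
  \sum_(n <- dom phi) (coeff n phi / sqrtC (\prod_(j < m) (n j)`!)%:R) *: 'X_[n].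

Definition change_modes V (P : {mpoly C[m]}) : {mpoly C[m]} :=
  P \mPo [tuple \sum_(k < m) V k j *: 'X_k | j < m].

(* Mode k is in the vacuum state iff the variable 'X_k does not occur. *)
Definition nb_occupied_modes (P : {mpoly C[m]}) : nat :=
  #|[set k : 'I_m | has (fun n : 'X_{1..m} => 0 < n k)%N (msupp P)]|.

Definition nb_intrinsic_modes phi (M : nat) : Prop :=
  (exists2 V, V \is unitarymx
     & nb_occupied_modes (change_modes V (stellar phi)) = M) /\
  (forall V, V \is unitarymx ->
     (M <= nb_occupied_modes (change_modes V (stellar phi)))%N).

(* The last field reads U a_j^dagger U^-1 = \sum_k V_kj a_k^dagger.  Such a U
   preserves the photon number, so on core vectors it is the restriction of a
   unitary operator of the whole Fock space, which it determines. *)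
Record interferometer := Interferometer {
  if_op :> {linear fock C m -> fock C m};
  if_mx : 'M[C]_m;
  if_mx_unitary : if_mx \is unitarymx;
  if_op_isometry : forall phi psi,
    braket (if_op phi) (if_op psi) = braket phi psi;
  if_op_surj : forall psi, exists phi, if_op phi = psi;
  if_op_vacuum : if_op vacuum = vacuum;
  if_op_creation : forall j phi,
    if_op (creation j phi) = \sum_(k < m) if_mx k j *: creation k (if_op phi)
}.

Variant operation :=
  | PhotonAddition of 'I_m
  | Multiport of interferometer.

Definition apply_operation phi (o : operation) : fock C m :=
  match o with
  | PhotonAddition j => creation j phi
  | Multiport U => U phi
  end.

Definition is_photon_addition (o : operation) : bool :=
  if o is PhotonAddition _ then true else false.

End Fock.

Section SingleAncilla.

Variables (C : numClosedFieldType) (m : nat).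

(* Of the m.+1 modes, the ancilla is ord_max and target mode j is
   fintype.lift ord_max j. *)
Definition target_part (q : 'X_{1..m.+1}) : 'X_{1..m} :=
  [multinom q (fintype.lift ord_max j) | j < m].

Definition project_ancilla (n : nat) (phi : fock C m.+1) : fock C m :=
  \sum_(q <- dom phi | q ord_max == n) << coeff q phi *g target_part q >>.

(* The operations are listed in order of application. *)
Record protocol := Protocol {
  operations : seq (operation C m.+1);
  detected : nat
}.

Definition output (p : protocol) : fock C m :=
  project_ancilla (detected p)
    (foldl (@apply_operation C m.+1) (vacuum C m.+1) (operations p)).

Definition prepares (p : protocol) (psi : fock C m) : Prop :=
  exists2 c : C, c != 0 & output p = c *: psi.

Definition nb_photon_additions (p : protocol) : nat :=
  count (@is_photon_addition C m.+1) (operations p).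

End SingleAncilla.

(* Main.v *)
(* Interferometers fix the vacuum and act linearly on creation operators, so
   before the projection the state is a product of N linear combinations of
   creation operators, i.e. its stellar polynomial is a product of N linear forms
   l_i(x) + c_i y, with y the variable of the ancilla.  Projecting onto |n>
   extracts, up to a scalar, the coefficient of y^n, a polynomial of degree at
   most N in the forms l_1, ..., l_N; hence d <= N.  A unitary change of the
   target modes sends the span of the l_i into the span of the first N variables,
   hence M <= N. *)
Require Import Defs.
From HB Require Import structures.
From mathcomp Require Import all_boot all_order all_algebra.

Set Implicit Arguments.
Unset Strict Implicit.
Unset Printing Implicit Defensive.

Local Open Scope ring_scope.

Import Order.TTheory GRing.Theory Num.Theory.

(** Evaluates the support sums that define creation, [stellar] and projection. The first hypothesis
    covers a [q0] outside the support, where the sum and [F q0] both vanish. *)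
Lemma big_dom_pred1 (C : nzRingType) (K : choiceType) (phi : {freeg K / C})
    (F : K -> C) :
  (forall q, coeff q phi = 0 -> F q = 0) ->
  forall q0, (forall q, q != q0 -> F q = 0) ->
  \sum_(q <- dom phi) F q = F q0.
Proof.
move=> F0 q0 Fq0; have [q0phi|] := boolP (q0 \in dom phi).
  by rewrite (bigD1_seq q0) ?uniq_dom //= big1 ?addr0.
rewrite mem_dom negbK => /eqP /F0 Fz; rewrite Fz big1 // => q _.
by have [->|/Fq0] := eqVneq q q0.
Qed.

(** * Stellar polynomials and the normal form of circuits *)

Section FockSpace.
Variables (C : numClosedFieldType) (m : nat).
Implicit Types (phi : fock C m) (q : 'X_{1..m}) (j : 'I_m) (u : 'rV[C]_m).

Lemma coeff_creation j phi q :
  coeff q (creation j phi)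
  = if (0 < q j)%N then sqrtC (q j)%:R * coeff (q - U_(j))%MM phi else 0.
Proof.
rewrite /creation raddf_sum /=.
under eq_bigr do rewrite coeffU.
have [qj0|qj0] := posnP (q j).
  rewrite big1 // => n _; case: eqP => [nq|]; last by rewrite mulr0.
  by move: qj0; rewrite -nq mnmDE mnm1E eqxx addn1.
rewrite (big_dom_pred1 _ (q0 := (q - U_(j))%MM)).
- have Uq : (U_(j) <= q)%MM by rewrite lep1mP -lt0n.
  by rewrite submK // eqxx mulr1 mnmBE mnm1E eqxx subn1 prednK // mulrC.
- by move=> n ->; rewrite !mul0r.
move=> n; case: (_ =P q) => [<-|]; last by rewrite mulr0.
by rewrite addmK eqxx.
Qed.

Lemma mcoeff_stellar phi q :
  (stellar phi)@_q = coeff q phi / sqrtC (\prod_(j < m) (q j)`!)%:R.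
Proof.
rewrite /stellar raddf_sum /=.
under eq_bigr do rewrite mcoeffZ mcoeffX.
rewrite (big_dom_pred1 _ (q0 := q)) ?eqxx ?mulr1 //.
  by move=> n ->; rewrite !mul0r.
by move=> n /negPf ->; rewrite mulr0.
Qed.

Lemma stellarD : {morph @stellar C m : phi psi / phi + psi}.
Proof.
move=> phi psi; apply/mpolyP=> q.
by rewrite mcoeffD !mcoeff_stellar raddfD /= mulrDl.
Qed.

Lemma stellarZ (c : C) phi : stellar (c *: phi) = c *: stellar phi.
Proof. by apply/mpolyP=> q; rewrite mcoeffZ !mcoeff_stellar coeffZ mulrA. Qed.

Lemma stellar0 : stellar (0 : fock C m) = 0.
Proof. by rewrite -(scale0r 0) stellarZ scale0r. Qed.

Lemma stellar_eq0 phi : (stellar phi == 0) = (phi == 0).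
Proof.
apply/eqP/eqP => [phi0|->]; last exact: stellar0.
apply/eqP/freeg_eqP => q; have /eqP := mcoeff_stellar phi q.
rewrite phi0 mcoeff0 eq_sym mulf_eq0 invr_eq0 sqrtC_eq0 pnatr_eq0 eqn0Ngt.
rewrite prodn_gt0 => [|j]; last exact: fact_gt0.
by rewrite orbF coeff0 => /eqP.
Qed.

Lemma stellar_vacuum : stellar (vacuum C m) = 1.
Proof.
apply/mpolyP=> q; rewrite mcoeff_stellar coeffU mcoeff1 mul1r eq_sym.
case: eqP => [->|]; last by rewrite mul0r.
by rewrite big1 ?sqrtC1 ?divr1 // => j _; rewrite mnm0E.
Qed.

(** The factor [sqrtC (q j)%:R] of the creation operator turns the normalisation of [q] into that of
    [q - U_(j)]. *)
Lemma stellar_creation j phi : stellar (creation j phi) = 'X_j * stellar phi.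
Proof.
apply/mpolyP=> q; rewrite mcoeff_stellar coeff_creation.
have [qj0|qj0] := posnP (q j).
  rewrite mul0r [RHS]mcoeffM big1 // => k /eqP qk; rewrite mcoeffX.
  case: eqP => [jk|]; last by rewrite mul0r.
  by move/(congr1 (fun n : 'X_{1..m} => n j)): qk; rewrite -jk mnmDE mnm1E eqxx qj0.
have Uq : (U_(j) <= q)%MM by rewrite lep1mP -lt0n.
rewrite -[in RHS](submK Uq) ['X_j * _]mulrC addmC mcoeffMX mcoeff_stellar.
have -> : (\prod_(i < m) (q i)`! = q j * \prod_(i < m) ((q - U_(j))%MM i)`!)%N.
  rewrite (bigD1 j) //= [in RHS](bigD1 j) //= mulnA; congr (_ * _)%N.
    by rewrite mnmBE mnm1E eqxx subn1; case: (q j) qj0.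
  by apply: eq_bigr => i /negPf ij; rewrite mnmBE mnm1E eq_sym ij subn0.
rewrite natrM rootCMl ?ler0n // invfM mulrACA.
by rewrite divff ?mul1r // sqrtC_eq0 pnatr_eq0 -lt0n.
Qed.

(** Creation in the superposed mode with amplitudes [u]: the general form of a photon addition
    conjugated by interferometers. *)
Definition add_photon u phi : fock C m := \sum_(k < m) u 0 k *: creation k phi.

Definition photon_state (us : seq 'rV[C]_m) : fock C m :=
  foldr add_photon (vacuum C m) us.

(** [U] moves past one creation operator at a time, rotating its amplitudes, until it reaches the
    vacuum and is absorbed. *)
Lemma interferometer_photon_state (U : interferometer C m) us :
  U (photon_state us) = photon_state [seq u *m (if_mx U)^T | u <- us].
Proof.
elim: us => [|u us IH]; first exact: if_op_vacuum.
rewrite /= -IH {1}/add_photon raddf_sum /=.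
under eq_bigr do rewrite linearZ /= if_op_creation scaler_sumr.
rewrite exchange_big; apply: eq_bigr => k _ /=.
rewrite mxE scaler_suml; apply: eq_bigr => j _.
by rewrite mxE scalerA.
Qed.

Lemma creation_add_photon j phi : creation j phi = add_photon (delta_mx 0 j) phi.
Proof.
rewrite /add_photon (bigD1 j) //= mxE !eqxx scale1r big1 ?addr0 // => k /negPf kj.
by rewrite mxE kj andbF scale0r.
Qed.

(** A photon addition prepends a basis row; an interferometer rotates all rows and leaves their
    number unchanged. *)
Lemma foldl_photon_state (os : seq (operation C m)) us :
  exists2 vs, foldl (@apply_operation C m) (photon_state us) os = photon_state vs
    & size vs = (count (@is_photon_addition C m) os + size us)%N.
Proof.
elim: os us => [|[j|U] os IH] us /=; first by exists us.
  rewrite creation_add_photon; have [vs -> vs_size] := IH (delta_mx 0 j :: us).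
  by exists vs; rewrite // vs_size addnS.
rewrite interferometer_photon_state.
have [vs -> vs_size] := IH [seq u *m (if_mx U)^T | u <- us].
by exists vs; rewrite // vs_size size_map.
Qed.

Definition linear_form u : {mpoly C[m]} := \sum_(k < m) u 0 k *: 'X_k.

Lemma change_modes_linear_form (V : 'M[C]_m) u :
  change_modes V (linear_form u) = linear_form (u *m V^T).
Proof.
rewrite /change_modes /linear_form raddf_sum /=.
under eq_bigr do rewrite comp_mpolyZ comp_mpolyXU nth_mktuple scaler_sumr.
rewrite exchange_big; apply: eq_bigr => k _ /=.
rewrite mxE scaler_suml; apply: eq_bigr => j _.
by rewrite mxE scalerA.
Qed.

(** Lets the degree bound come from the same estimate as the mode bound, with the identity as change
    of modes. *)
Lemma change_modes1 (P : {mpoly C[m]}) : change_modes 1%:M P = P.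
Proof.
rewrite /change_modes -[RHS]comp_mpoly_id; congr comp_mpoly.
apply: eq_mktuple => j; rewrite (bigD1 j) //= mxE eqxx scale1r.
by rewrite big1 ?addr0 // => k /negPf kj; rewrite mxE kj scale0r.
Qed.

End FockSpace.

(** * Joint control of the degree and of the variables of a polynomial *)

Section Support.
Variables (C : numClosedFieldType) (m : nat) (A : {pred 'I_m}).
Implicit Types (P Q : {mpoly C[m]}) (e f : nat).

(** Degree and variables are bounded together so that a single induction on the photons serves both
    inequalities. *)
Definition bounded_in e P : Prop :=
  forall n : 'X_{1..m}, n \in msupp P ->
    (mdeg n <= e)%N /\ forall k, k \notin A -> n k = 0%N.

Lemma bounded_in0 e : bounded_in e 0.
Proof. by move=> n; rewrite msupp0. Qed.

Lemma bounded_inC e c : bounded_in e c%:MP.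
Proof.
move=> n; rewrite msuppC; case: ifP => // _; rewrite inE => /eqP ->.
by rewrite mdeg0; split=> // k _; rewrite mnm0E.
Qed.

Lemma bounded_in_leq e f P : (e <= f)%N -> bounded_in e P -> bounded_in f P.
Proof. by move=> ef Pe n /Pe[ne nA]; split=> //; apply: leq_trans ef. Qed.

Lemma bounded_inD e P Q : bounded_in e P -> bounded_in e Q -> bounded_in e (P + Q).
Proof. by move=> Pe Qe n /msuppD_le; rewrite mem_cat => /orP[/Pe|/Qe]. Qed.

Lemma bounded_inZ e c P : bounded_in e P -> bounded_in e (c *: P).
Proof. by move=> Pe n /msuppZ_le /Pe. Qed.

Lemma bounded_inM e f P Q :
  bounded_in e P -> bounded_in f Q -> bounded_in (e + f) (P * Q).
Proof.
move=> Pe Qf n /msuppM_le /allpairsP[[n1 n2] /= [/Pe[n1e n1A] /Qf[n2f n2A] ->]].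
split=> [|k kA]; first by rewrite mdegD leq_add.
by rewrite mnmDE n1A ?n2A.
Qed.

Lemma bounded_in_linear_form (u : 'rV[C]_m) :
  (forall k, k \notin A -> u 0 k = 0) -> bounded_in 1 (linear_form u).
Proof.
move=> uA; rewrite /linear_form; elim/big_ind: _ => [||k _].
- exact: bounded_in0.
- exact: bounded_inD.
have [kA|/uA ->] := boolP (k \in A); last by rewrite scale0r; apply: bounded_in0.
apply: bounded_inZ => n; rewrite msuppX inE => /eqP ->.
rewrite mdeg1; split=> // l lA; rewrite mnm1E; case: eqP => // kl.
by rewrite kl (negPf lA) in kA.
Qed.

Lemma nb_occupied_modes_leq e P : bounded_in e P -> (nb_occupied_modes P <= #|A|)%N.
Proof.
move=> Pe; apply/subset_leq_card/subsetP => k; rewrite inE => /hasP[n /Pe[_ nA]].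
by apply: contraTT => /nA ->.
Qed.

End Support.

(** * Projection of the ancilla and its effect on stellar polynomials *)

Section Projection.
Variables (C : numClosedFieldType) (m : nat).
Implicit Types (phi : fock C m.+1) (q : 'X_{1..m}) (u : 'rV[C]_m.+1).

Definition extend_mnm (n : nat) q : 'X_{1..m.+1} :=
  [multinom (if unlift ord_max i is Some j then q j else n) | i < m.+1].

Lemma extend_mnm_lift n q j : extend_mnm n q (fintype.lift ord_max j) = q j.
Proof. by rewrite mnmE liftK. Qed.

Lemma extend_mnm_max n q : extend_mnm n q ord_max = n.
Proof. by rewrite mnmE unlift_none. Qed.

(** With the ancilla occupation fixed, [target_part] is injective, so each amplitude after
    projection comes from a single Fock state. *)
Lemma target_part_eq (n : nat) q (r : 'X_{1..m.+1}) :
  (r ord_max == n) && (target_part r == q) = (r == extend_mnm n q).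
Proof.
apply/andP/eqP => [[/eqP rn /eqP rq]|->].
  apply/mnmP => i; rewrite mnmE; case: unliftP => [j|] -> //.
  by rewrite -rq mnmE.
rewrite extend_mnm_max; split=> //; apply/eqP/mnmP => j.
by rewrite mnmE extend_mnm_lift.
Qed.

Lemma coeff_project_ancilla n phi q :
  coeff q (project_ancilla n phi) = coeff (extend_mnm n q) phi.
Proof.
rewrite /project_ancilla raddf_sum /= big_mkcond /=.
rewrite (big_dom_pred1 _ (q0 := extend_mnm n q)).
- rewrite extend_mnm_max eqxx coeffU.
  have /andP[_ /eqP ->] : (extend_mnm n q ord_max == n)
      && (target_part (extend_mnm n q) == q) by rewrite target_part_eq.
  by rewrite eqxx mulr1.
- by move=> r r0; case: ifP => // _; rewrite coeffU r0 mul0r.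
move=> r; rewrite -target_part_eq; case: eqP => //= _ /negPf.
by rewrite coeffU => ->; rewrite mulr0.
Qed.

Lemma project_ancillaD n : {morph @project_ancilla C m n : phi psi / phi + psi}.
Proof.
move=> phi psi; apply/eqP/freeg_eqP => q.
by rewrite coeffD !coeff_project_ancilla coeffD.
Qed.

Lemma project_ancillaZ n c phi :
  project_ancilla n (c *: phi) = c *: project_ancilla n phi.
Proof.
by apply/eqP/freeg_eqP => q; rewrite coeffZ !coeff_project_ancilla coeffZ.
Qed.

Lemma project_ancilla0 n : project_ancilla n (0 : fock C m.+1) = 0.
Proof. by rewrite -(scale0r 0) project_ancillaZ scale0r. Qed.

Lemma project_ancilla_vacuum n :
  project_ancilla n (vacuum C m.+1) = (n == 0)%N%:R *: vacuum C m.
Proof.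
apply/eqP/freeg_eqP => q; rewrite coeffZ coeff_project_ancilla !coeffU !mul1r.
rewrite -target_part_eq mnm0E eq_sym -natrM mulnb; congr ((_ && _)%:R).
by congr (_ == q); apply/mnmP => j; rewrite mnmE !mnm0E.
Qed.

Lemma project_ancilla_creation_target n j phi :
  project_ancilla n (creation (fintype.lift ord_max j) phi)
  = creation j (project_ancilla n phi).
Proof.
apply/eqP/freeg_eqP => q; rewrite coeff_project_ancilla !coeff_creation.
rewrite extend_mnm_lift coeff_project_ancilla; case: ifP => // _.
congr (_ * coeff _ phi); apply/eqP; rewrite -target_part_eq.
rewrite mnmBE mnm1E extend_mnm_max lift_eqF subn0 eqxx /=.
apply/eqP/mnmP => i; rewrite mnmE !mnmBE !mnm1E extend_mnm_lift.
by rewrite (inj_eq (@lift_inj _ _)).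
Qed.

(* At [n = 0] the factor [sqrtC 0] makes the junk value [0.-1 = 0] harmless. *)
Lemma project_ancilla_creation_ancilla n phi :
  project_ancilla n (creation ord_max phi)
  = sqrtC n%:R *: project_ancilla n.-1 phi.
Proof.
apply/eqP/freeg_eqP => q; rewrite coeffZ !coeff_project_ancilla coeff_creation.
rewrite extend_mnm_max; case: posnP => [->|n0]; first by rewrite sqrtC0 mul0r.
congr (_ * coeff _ phi); apply/eqP; rewrite -target_part_eq.
rewrite mnmBE mnm1E extend_mnm_max eqxx subn1 eqxx /=.
apply/eqP/mnmP => i; rewrite mnmE mnmBE mnm1E extend_mnm_lift.
by rewrite eq_liftF subn0.
Qed.

(** The coefficient of [y^n] in [(l + c y) F] is [l F_n + c F_(n-1)]. Projection onto [n] photons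
    yields [sqrt(n!) F_n], whence the factor [sqrtC n%:R]. *)
Lemma stellar_project_add_photon n u phi :
  stellar (project_ancilla n (add_photon u phi))
  = linear_form (col' ord_max u) * stellar (project_ancilla n phi)
    + (u 0 ord_max * sqrtC n%:R) *: stellar (project_ancilla n.-1 phi).
Proof.
rewrite /add_photon (bigD1_ord ord_max) //= addrC project_ancillaD stellarD.
congr (_ + _); last first.
  by rewrite project_ancillaZ project_ancilla_creation_ancilla scalerA stellarZ.
rewrite /linear_form mulr_suml.
rewrite (big_morph _ (@project_ancillaD n) (project_ancilla0 n)).
rewrite (big_morph _ (@stellarD C m) (stellar0 C m)); apply: eq_bigr => j _.
rewrite project_ancillaZ project_ancilla_creation_target stellarZ stellar_creation.
by rewrite mxE -scalerAl.
Qed.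

(** Each photon either multiplies by its linear form, raising the degree by one within the variables
    of [A], or goes to the ancilla and lowers [n]. Hence [n] varies in the induction. *)
Lemma bounded_in_project_photon_state (V : 'M[C]_m) (A : {pred 'I_m}) us n :
  (forall u, u \in us -> forall k, k \notin A -> (col' ord_max u *m V^T) 0 k = 0) ->
  bounded_in A (size us)
    (change_modes V (stellar (project_ancilla n (photon_state us)))).
Proof.
elim: us n => [|u us IH] n usA /=.
  rewrite project_ancilla_vacuum stellarZ stellar_vacuum /change_modes.
  by rewrite comp_mpolyZ comp_mpoly1; apply/bounded_inZ/bounded_inC.
have {}IH n' : bounded_in A (size us)
    (change_modes V (stellar (project_ancilla n' (photon_state us)))).
  by apply: IH => v vus; apply: usA; rewrite inE vus orbT.
rewrite stellar_project_add_photon /change_modes comp_mpolyD comp_mpolyZ rmorphM /=.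
apply: bounded_inD.
  rewrite -add1n; apply: bounded_inM; last exact: IH.
  rewrite [_ \mPo _]change_modes_linear_form; apply: bounded_in_linear_form.
  by apply: usA; rewrite mem_head.
by apply: (bounded_in_leq (leqnSn _)); apply/bounded_inZ/IH.
Qed.

End Projection.

(* Gram-Schmidt: [us`_i] lies in the span of the rows 0, ..., i of the unitary
   matrix [schmidt B], hence is orthogonal to every later row. *)
Lemma unitary_compress (C : numClosedFieldType) (m : nat) (us : seq 'rV[C]_m) :
  exists2 V : 'M[C]_m, V \is unitarymx &
    forall u, u \in us -> forall k : 'I_m, (size us <= k)%N -> (u *m V^T) 0 k = 0.
Proof.
pose B : 'M[C]_m := \matrix_(i < m) us`_i.
have SU : schmidt B \is unitarymx by apply: schmidt_unitarymx.
(* The conjugate makes entry [k] of [u *m V^T] the Hermitian product of [u] with row [k] of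
   [schmidt B]. *)
exists (map_mx Num.conj (schmidt B)); first by rewrite conjC_unitary.
move=> u uus k us_k; have iu : (index u us < size us)%N by rewrite index_mem.
(* [B] keeps only the first [m] vectors, but a mode [k] past [size us] forces [size us < m], so [u]
   is a row of [B]. *)
have im : (index u us < m)%N by
  exact: leq_trans iu (leq_trans us_k (ltnW (ltn_ord k))).
have := row_schmidt_sub B (Ordinal im); rewrite rowK /= nth_index //.
(* Orthogonality to row [k] is written as membership in a kernel, so that it need only be checked on
   the rows spanning a space that contains [u]. *)
move=> u_sub; have : (u <= kermx (map_mx Num.conj (row k (schmidt B))^T))%MS.
  apply: submx_trans u_sub _; apply/sumsmx_subP => l /= li.
  rewrite genmxE; apply/sub_kermxP/matrixP => i j; rewrite !ord1 -dotmxE.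
  rewrite (row_unitarymxP SU) mxE; case: eqP => // lk.
  by rewrite lk in li; have := leq_ltn_trans (leq_trans us_k li) iu; rewrite ltnn.
move/sub_kermxP/matrixP/(_ 0 0); rewrite !mxE => u_row0.
by rewrite -[RHS]u_row0; apply: eq_bigr => j _; rewrite !mxE.
Qed.

Theorem corollary1 (R : realType) (m d M : nat) (psi : fock R[i] m)
  (psi_neq0 : psi != 0)
  (psi_homog : stellar psi \is d.-homog)
  (psi_modes : nb_intrinsic_modes psi M)
  (M_ge2 : (2 <= M)%N)
  (p : protocol R[i] m) (p_prepares : prepares p psi) :
  (maxn d M <= nb_photon_additions p)%N.
Proof.
have [c c0 p_out] := p_prepares.
have [us state_us size_us] := foldl_photon_state (operations p) [::].
rewrite addn0 in size_us.
have psi_stellar : stellar psi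
    = c^-1 *: stellar (project_ancilla (detected p) (photon_state us)).
  by rewrite -state_us -[project_ancilla _ _]/(output p) p_out stellarZ scalerK.
rewrite geq_max -[nb_photon_additions p]size_us; apply/andP; split.
  (* A nonzero state has some monomial in its stellar polynomial, and homogeneity gives it degree
     [d]. *)
  have [q q_psi] : exists q, q \in msupp (stellar psi).
    case E: (msupp _) => [|q s]; last by exists q; rewrite mem_head.
    by rewrite -stellar_eq0 -msupp_eq0 E eqxx in psi_neq0.
  have /dhomogP/(_ q q_psi) <- := psi_homog.
  have psi_deg : bounded_in predT (size us) (stellar psi).
    rewrite psi_stellar -[stellar (project_ancilla _ _)]change_modes1.
    by apply/bounded_inZ/bounded_in_project_photon_state.
  by have [] := psi_deg q q_psi.
have [_ M_min] := psi_modes.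
have [V V_unitary V_us] := unitary_compress [seq col' ord_max u | u <- us].
apply: leq_trans (M_min V V_unitary) _.
pose A : {pred 'I_m} := [pred k : 'I_m | (k < size us)%N].
(* Only an inequality, since there may be more photons than target modes. *)
have card_A : (#|A| <= size us)%N.
  rewrite cardE -(size_map val) -(size_iota 0 (size us)) uniq_leq_size //.
    by rewrite (map_inj_uniq val_inj) enum_uniq.
  by move=> _ /mapP[k kA ->]; rewrite mem_enum in kA; rewrite mem_iota.
apply: leq_trans card_A; apply: (nb_occupied_modes_leq (e := size us)).
rewrite psi_stellar /change_modes comp_mpolyZ; apply: bounded_inZ.
apply: bounded_in_project_photon_state => u uus k.
rewrite inE -leqNgt => us_k; apply: V_us; first exact: map_f.
by rewrite size_map.
Qed.
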